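(* Let $I$ be an arbitrary Bin Packing instance with capacity $W$, and let $a,b,c\in I$ be pairwise distinct items such that $w_a+w_b+w_c=W$ and there is no full pattern containing $a$ whose other items all lie in $I\setminus\{a,b,c\}$. If $I$ admits a perfect packing, then $I$ admits a perfect packing in which $\{a,b,c\}$ is one of the parts.
   Context: A Bin Packing instance consists of a finite set $I$ of items with positive integer weights $w_i$ and a positive integer capacity $W$. A full pattern is a subset $P\subseteq I$ with $\sum_{i\in P}w_i=W$. A perfect packing is a partition of $I$ into full patterns. *)

(* Defs.v *)
From mathcomp Require Import all_boot.

Set Implicit Arguments.
Unset Strict Implicit.
Unset Printing Implicit Defensive.

Definition full_pattern (I : finType) (w : I -> nat) (W : nat) (P : {set I}) : Prop :=
  \sum_(i in P) w i = W.

(* [partition] requires nonempty blocks; this excludes nothing when [0 < W],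
   since a full pattern is then nonempty. *)
Definition perfect_packing (I : finType) (w : I -> nat) (W : nat)
    (Q : {set {set I}}) : Prop :=
  partition Q [set: I] /\ (forall P : {set I}, P \in Q -> full_pattern w W P).

(* Main.v *)
(** The block [A] of [a] must contain [b] or [c]. If it contains both, it
    equals [{a, b, c}] since weights are positive. Otherwise, with [e] the
    missing item and [B] its block, [{a, b, c}] is a full pattern inside
    [A :|: B], which weighs [2 * W]; what remains of [A :|: B] is then full. *)

Require Import Defs.
From mathcomp Require Import all_boot.

Lemma sum_weight_setD {I : finType} (w : I -> nat) {A B : {set I}} :
  A \subset B ->
  \sum_(i in B) w i = \sum_(i in A) w i + \sum_(i in B :\: A) w i.
Proof. by move=> sAB; rewrite (big_setID A) /= (setIidPr sAB). Qed.

(** An item of [P'] outside [P] would add positive weight to the [W] that [P] already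
    contributes. *)
Lemma full_pattern_sub_eq {I : finType} {w : I -> nat} {W : nat}
    {P P' : {set I}} :
  (forall i, 0 < w i) -> full_pattern w W P -> full_pattern w W P' ->
  P \subset P' -> P = P'.
Proof.
move=> w_gt0 fP fP' sPP'; apply/eqP; rewrite eqEsubset sPP' -setD_eq0.
apply: contraT => /set0Pn[x xD].
have := sum_weight_setD w sPP'; rewrite fP fP' (bigD1 x xD) /=.
by move/eqP; rewrite -[eqbLHS]addn0 eqn_add2l eq_sym addn_eq0 eqn0Ngt w_gt0.
Qed.

Lemma full_pattern_neq0 {I : finType} {w : I -> nat} {W : nat} {P : {set I}} :
  0 < W -> full_pattern w W P -> P != set0.
Proof.
by move=> W_gt0 fP; apply: contraTneq W_gt0 => P0; rewrite -fP P0 big_set0.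
Qed.

(** The blocks [A] and [B] are traded for [X] and the remainder of [A :|: B]; all other blocks
    stay. *)
Lemma perfect_packing_exchange {I : finType} {w : I -> nat} {W : nat}
    {Q : {set {set I}}} {A B X : {set I}} :
  0 < W -> perfect_packing w W Q -> A \in Q -> B \in Q -> A != B ->
  full_pattern w W X -> X \subset A :|: B ->
  exists Q' : {set {set I}}, perfect_packing w W Q' /\ X \in Q'.
Proof.
move=> W_gt0 [partQ fullQ] AQ BQ neqAB fX sXAB.
have dAB : [disjoint A & B] by apply: (trivIsetP (partition_trivIset partQ)).
set Y := (A :|: B) :\: X.
have fY : full_pattern w W Y.
  (* Weighing [A :|: B] once by [A] and [B] and once by [X] and [Y] gives [W + W] equal to [W] plus
     the weight of [Y]. *)
  have := sum_weight_setD w sXAB.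
  rewrite (sum_weight_setD w (subsetUl A B)) setDUl setDv set0U.
  have /setDidPl-> : [disjoint B & A] by rewrite disjoint_sym.
  by rewrite (fullQ A AQ) (fullQ B BQ) fX => /addnI.
(* The untouched blocks partition the complement of [A :|: B]; [Y] and then [X] are adjoined as new
   blocks, nonempty because [0 < W]. *)
have partQ2 : partition (Q :\ A :\ B) (~: (A :|: B)).
  have BQA : B \in Q :\ A by rewrite !inE eq_sym neqAB.
  by have := partitionD1 (partitionD1 partQ AQ) BQA; rewrite (setDDl setT) setTD.
have dY : [disjoint Y & ~: (A :|: B)] by rewrite -subsets_disjoint subsetDl.
have partY := partitionU1 partQ2 (full_pattern_neq0 W_gt0 fY) dY.
have dX : [disjoint X & Y :|: ~: (A :|: B)].
  rewrite disjoint_sym disjoints_subset subUset setCS sXAB andbT.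
  by rewrite /Y setDE subsetIr.
have partX := partitionU1 partY (full_pattern_neq0 W_gt0 fX) dX.
have coverX : X :|: (Y :|: ~: (A :|: B)) = [set: I].
  by rewrite setUA -{1}(setIidPr sXAB) setID setUCr.
exists (X |: (Y |: Q :\ A :\ B)); split; last exact: setU11.
split; first by rewrite -coverX.
by move=> P; rewrite !inE => /or3P[/eqP-> // | /eqP-> // | /and3P[_ _ /fullQ]].
Qed.

Theorem theorem3 (I : finType) (w : I -> nat) (W : nat)
    (w_gt0 : forall i : I, 0 < w i) (W_gt0 : 0 < W)
    (a b c : I) (neq_ab : a <> b) (neq_ac : a <> c) (neq_bc : b <> c)
    (w_abc : w a + w b + w c = W)
    (no_pattern : ~ exists P : {set I},
       [/\ full_pattern w W P, a \in P & P :\ a \subset [set: I] :\: [set a; b; c]]) :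
  (exists Q : {set {set I}}, perfect_packing w W Q) ->
  exists Q : {set {set I}}, perfect_packing w W Q /\ [set a; b; c] \in Q.
Proof.
case=> Q packQ; have [partQ fullQ] := packQ.
have memQ x : x \in pblock Q x by rewrite mem_pblock (cover_partition partQ) inE.
have blockQ x : pblock Q x \in Q by rewrite pblock_mem ?(cover_partition partQ) ?inE.
have fX : full_pattern w W [set a; b; c].
  (* [[set a; b; c]] is [[set a; b] :|: [set c]], so [setUC] puts [c] in front and it is split off
     first. *)
  rewrite /full_pattern -w_abc setUC big_setU1 ?inE; last first.
    by apply/norP; split; apply/eqP => ec; [case: neq_ac | case: neq_bc].
  by rewrite big_setU1 ?inE ?big_set1; [rewrite addnC | apply/eqP].
set A := pblock Q a.
(* Used with [e] equal to [c] or [b]; [e \notin A] makes the two blocks distinct. *)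
have exchange e : e \notin A -> [set a; b; c] \subset A :|: pblock Q e ->
    exists Q : {set {set I}}, perfect_packing w W Q /\ [set a; b; c] \in Q.
  move=> eA; apply: (perfect_packing_exchange W_gt0 packQ (blockQ a) (blockQ e) _ fX).
  by apply: contraNneq eA; rewrite -/A => ->.
have subX (D : {set I}) : a \in D -> b \in D -> c \in D -> [set a; b; c] \subset D.
  by move=> aD bD cD; rewrite !subUset !sub1set aD bD cD.
have [bA | bA] := boolP (b \in A); have [cA | cA] := boolP (c \in A).
- exists Q; split=> //.
  by rewrite (full_pattern_sub_eq w_gt0 fX (fullQ _ (blockQ a))) ?subX.
- by apply: (exchange c cA); apply: subX; rewrite inE ?memQ ?bA ?orbT.
- by apply: (exchange b bA); apply: subX; rewrite inE ?memQ ?cA ?orbT.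
(* With neither [b] nor [c] in [A], the block [A] is itself a pattern of the excluded kind. *)
case: no_pattern; exists A; split; [exact: fullQ (blockQ a) | exact: memQ |].
apply/subsetP=> x; rewrite !inE => /andP[xa xA]; rewrite (negbTE xa) andbT /=.
by apply/norP; split; apply: contraTneq xA => ->.
Qed.
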